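(* Let $q\geq 2$ and $k\geq 2$ be integers, and $I$ an instance of $\mathsf{k\,CSP\!-\!q}$ with strong chromatic number $\nu\in\{k,\ldots,\max\{k+1,2q\}\}$. Let $p^\kappa$ ($p$ prime, $\kappa\ge1$) be the smallest prime power greater than or equal to $q$. Then the average differential ratio on $I$ is bounded below by: 1. $1/q^k$ if $\nu\leq k+1$, or $q>k$ is a prime power and $\nu\leq q+1$, or $k=3$, $q>3$ is a power of 2, and $\nu\leq q+2$; 2. $1/p^{\kappa k}$, and thus by $1/(2q-2)^k$, if $p^\kappa>k$ and $\nu\leq p^\kappa+1$; 3. $1/2^{3\lceil\log_2 q\rceil}$, and thus by $1/(2q-2)^3$, if $k=3$, $q\geq 3$, and $\nu\leq 2^{\lceil\log_2 q\rceil}+2$.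
   Context: Let $\Sigma_q=\{0,1,\ldots,q-1\}$ and $[n]=\{1,\ldots,n\}$. An instance $I$ of $\mathsf{k\,CSP\!-\!q}$ consists of integers $n,m\ge 1$, a goal (maximize or minimize) and, for each $i\in[m]$, a weight $w_i>0$, an integer $1\le k_i\leq \min\{k,n\}$, a strictly increasing sequence $J_i=(i_1,\ldots,i_{k_i})$ of indices of $[n]$, and a function $P_i:\Sigma_q^{k_i}\to\mathbb{R}$. Solutions are vectors $x\in\Sigma_q^n$, with value $v(I,x)=\sum_{i=1}^m w_iP_i(x_{i_1},\ldots,x_{i_{k_i}})$. $\mathrm{opt}(I)$ and $\mathrm{wor}(I)$ are the best and worst solution values (maximum and minimum of $v(I,\cdot)$ if maximizing, minimum and maximum if minimizing). The average differential ratio on $I$ is $(\mathbb{E}_X[v(I,X)]-\mathrm{wor}(I))/(\mathrm{opt}(I)-\mathrm{wor}(I))$ with $X$ uniform on $\Sigma_q^n$ (considered when $\mathrm{opt}(I)\neq\mathrm{wor}(I)$). The strong chromatic number of $I$ is the smallest $\nu$ such that there is a partition of $[n]$ into $\nu$ sets such that each $J_i$ contains at most one index from each set. *)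

(* Defs.v *)
From mathcomp Require Import all_boot all_order all_algebra reals.

Set Implicit Arguments.
Unset Strict Implicit.
Unset Printing Implicit Defensive.
Import Order.TTheory GRing.Theory Num.Theory.

Local Open Scope ring_scope.

Inductive csp_goal := Maximize | Minimize.

(* Variables and constraints are indexed from 0, and Sigma_q is 'I_q. *)
Record csp_instance (R : realType) (k q : nat) := CspInstance {
  nvars : nat;
  nconstraints : nat;
  goal : csp_goal;
  weight : 'I_nconstraints -> R;
  arity : 'I_nconstraints -> nat;
  scope : forall i, (arity i).-tuple 'I_nvars;
  payoff : forall i, (arity i).-tuple 'I_q -> R;
  nvars_ge1 : (1 <= nvars)%N;
  nconstraints_ge1 : (1 <= nconstraints)%N;
  weight_gt0 : forall i, 0 < weight i;
  arity_bounds : forall i, (1 <= arity i <= minn k nvars)%N;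
  scope_increasing : forall i,
    sorted (fun a b : 'I_nvars => (a < b)%N) (scope i)
}.

Section FiniteExtrema.
Variables (R : realType) (T : finType) (f : T -> R).

(* The default 0 is only reached when T is empty. *)
Definition maximum : R :=
  if [pick x | [forall y, f y <= f x]] is Some x then f x else 0.

Definition minimum : R :=
  if [pick x | [forall y, f x <= f y]] is Some x then f x else 0.

Definition uniform_mean : R := (\sum_x f x) / #|T|%:R.

End FiniteExtrema.

Section CspInstanceTheory.
Variables (R : realType) (k q : nat) (I : csp_instance R k q).

Definition solution := {ffun 'I_(nvars I) -> 'I_q}.

Definition value (x : solution) : R :=
  \sum_i weight i * payoff (map_tuple x (scope (c:=I) i)).

Definition opt : R :=
  match goal I with
  | Maximize => maximum value
  | Minimize => minimum value
  end.

Definition wor : R :=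
  match goal I with
  | Maximize => minimum value
  | Minimize => maximum value
  end.

Definition average_differential_ratio : R :=
  (uniform_mean value - wor) / (opt - wor).

Definition strong_coloring (P : {set {set 'I_(nvars I)}}) : bool :=
  partition P [set: 'I_(nvars I)] &&
  [forall i, [forall A in P, (#|A :&: [set j in scope (c:=I) i]| <= 1)%N]].

Definition strongly_colorable (nu : nat) : bool :=
  [exists P, strong_coloring P && (#|P| == nu)].

Lemma strongly_colorable_exists : exists nu, strongly_colorable nu.
Proof.
pose P := preim_partition (@id 'I_(nvars I)) [set: 'I_(nvars I)].
exists #|P|; apply/existsP; exists P; rewrite eqxx andbT /strong_coloring.
rewrite preim_partitionP /=; apply/forallP => i.
apply/forall_inP => A /imsetP[x _ ->].
rewrite -(cards1 x); apply/subset_leq_card/subsetP => y.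
by rewrite !inE => /andP[/eqP ->].
Qed.

Definition strong_chromatic_number : nat := ex_minn strongly_colorable_exists.

End CspInstanceTheory.

Definition prime_power (a : nat) : Prop :=
  exists p kappa : nat, [/\ prime p, (1 <= kappa)%N & a = (p ^ kappa)%N].

Definition smallest_prime_power_geq (q a : nat) : Prop :=
  [/\ prime_power a, (q <= a)%N
    & forall b, prime_power b -> (q <= b)%N -> (a <= b)%N].

(* Main.v *)
Require Import Defs.
From mathcomp Require Import all_boot all_order all_algebra all_field reals.
From mathcomp Require Import ring lra zify.
Import Order.TTheory GRing.Theory Num.Theory.
Local Open Scope ring_scope.

Set Implicit Arguments.
Unset Strict Implicit.
Unset Printing Implicit Defensive.

(** The idea is to find few solutions, one of them optimal, whose average value
    is the mean value of all solutions.

    Suppose first that q is the size of an additive group A.  Take an additive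
    map from a finite group G to words over A, indexed by colours, whose image
    is an orthogonal array of strength k: any at most k entries of a random
    word are independent and uniform.  Colour the variables so that no
    constraint sees a colour twice, and shift an optimal solution x0 by each
    word, adding to a variable the entry of its colour.  A constraint reads at
    most k colours, hence sees uniform independent values, and the |G| shifts
    have the mean value on average.  The word of 0 shifts x0 to itself and the
    other shifts are at least as good as the worst solution, so the ratio is at
    least 1/|G|.

    When q is smaller than |A|, letters of A are turned into values at random,
    independently at each variable, by a kernel which sends the letter 0 to
    the optimal value and a uniform letter to a uniform value.  Replacing an
    objective by its expectation under this kernel ([smoothing]), a function of
    words over A, keeps its mean, its lower bounds and the variables it depends
    on, and its value at the zero word is that of x0, so the same argument
    applies; it even replaces the shift when q = |A|.  These two steps
    are [array_average] and [sum_smoothing]; [mean_sub_ge] combines them.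

    It remains to supply arrays with |A|^k words: the zero-sum words on k + 1
    columns over any cyclic group, the Reed-Solomon words extended by a point
    at infinity on |F| + 1 columns over a field F, and, for k = 3 in
    characteristic 2, their extension by one more column, which is the nucleus
    of a conic.  Bounds in terms of q alone follow because the least power of 2
    that is at least q is at most 2q - 2. *)

(** * Elementary sums *)

Lemma sum_eq_indicator (R : pzRingType) (B : finType) (b0 : B) :
  \sum_b (b == b0)%:R = 1 :> R.
Proof.
rewrite (bigD1 b0) //= eqxx big1 ?addr0 // => b /negbTE -> //.
Qed.

Lemma sum_const (R : pzRingType) (B : finType) (c : R) :
  \sum_(b : B) c = #|B|%:R * c.
Proof. by rewrite sumr_const mulr_natl. Qed.

Lemma sum_const_neq0 (R : pzRingType) (B : finZmodType) (c : R) :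
  \sum_(b : B | b != 0) c = (#|B|%:R - 1) * c.
Proof.
rewrite mulrBl mul1r -(sum_const B c) [in RHS](bigD1 0) //=.
by rewrite addrAC subrr add0r.
Qed.

(** * Expectation under a kernel that pins one letter *)

Definition depends_only_on (V B : finType) (R : Type) (S : {set V})
    (h : {ffun V -> B} -> R) :=
  forall x y : {ffun V -> B}, {in S, x =1 y} -> h x = h y.

Section Smoothing.

Variables (R : realFieldType) (V T : finType) (A : finZmodType).
Hypotheses (T_gt0 : (0 < #|T|)%N) (A_gt1 : (1 < #|A|)%N).
Hypothesis leTA : (#|T| <= #|A|)%N.

(** The probability of the value t given the letter a.  The letter 0 gives t0
    surely; the other letters share one law, the only one that makes the image
    of a uniform letter uniform.  It is nonnegative since |T| <= |A|. *)
Definition pinned_kernel (t0 : T) (a : A) (t : T) : R :=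
  if a == 0 then (t == t0)%:R
  else (#|A|%:R / #|T|%:R - (t == t0)%:R) / (#|A|%:R - 1).

Lemma natr_card_sub1_gt0 : 0 < #|A|%:R - 1 :> R.
Proof. by rewrite subr_gt0 ltr1n. Qed.

Lemma pinned_kernel_ge0 t0 a t : 0 <= pinned_kernel t0 a t.
Proof.
rewrite /pinned_kernel; case: ifP => _; first exact: ler0n.
rewrite divr_ge0 ?(ltW natr_card_sub1_gt0) // subr_ge0.
have leAT : 1 <= #|A|%:R / #|T|%:R :> R.
  by rewrite ler_pdivlMr ?ltr0n // mul1r ler_nat.
by case: (t == t0); rewrite // (le_trans ler01).
Qed.

Lemma sum_pinned_kernel t0 a : \sum_t pinned_kernel t0 a t = 1.
Proof.
rewrite /pinned_kernel; case: (a == 0); first exact: sum_eq_indicator.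
rewrite -mulr_suml sumrB sum_eq_indicator sum_const.
rewrite [X in X - _]mulrC divfK ?pnatr_eq0 -?lt0n // divff // gt_eqF //.
exact: natr_card_sub1_gt0.
Qed.

Lemma pinned_kernel_balanced t0 t :
  \sum_a pinned_kernel t0 a t = #|A|%:R / #|T|%:R.
Proof.
rewrite (bigD1 0) //= {1}/pinned_kernel eqxx.
under eq_bigr => a a_neq0 do rewrite /pinned_kernel (negbTE a_neq0).
rewrite sum_const_neq0 mulrC divfK ?subrKC //.
by rewrite gt_eqF // natr_card_sub1_gt0.
Qed.

Definition smoothing (x0 : {ffun V -> T}) (u : {ffun V -> T} -> R)
    (a : {ffun V -> A}) : R :=
  \sum_(x : {ffun V -> T}) (\prod_j pinned_kernel (x0 j) (a j) (x j)) * u x.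

Variable x0 : {ffun V -> T}.

Lemma sum_prod_pinned_kernel (a : {ffun V -> A}) :
  \sum_(x : {ffun V -> T}) \prod_j pinned_kernel (x0 j) (a j) (x j) = 1.
Proof.
rewrite -(bigA_distr_bigA (fun j t => pinned_kernel (x0 j) (a j) t)).
by rewrite big1 // => j _; rewrite sum_pinned_kernel.
Qed.

(** At the zero word all the kernels are Dirac masses. *)
Lemma smoothing0 u : smoothing x0 u [ffun=> 0] = u x0.
Proof.
rewrite /smoothing (bigD1 x0) //= !big1 ?addr0 ?mul1r //; last first.
  by move=> j _; rewrite ffunE /pinned_kernel !eqxx.
move=> x x_neq; have [j xj_neq] : exists j, x j != x0 j.
  apply/existsP; apply: contraR x_neq; rewrite negb_exists => /forallP eq_x.
  by apply/eqP/ffunP => j; apply/eqP/negPn/eq_x.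
by rewrite (bigD1 j) //= ffunE /pinned_kernel eqxx (negbTE xj_neq) !mul0r.
Qed.

Lemma smoothing_ge u lo a : (forall x, lo <= u x) -> lo <= smoothing x0 u a.
Proof.
move=> lo_u; rewrite -[lo]mul1r -(sum_prod_pinned_kernel a) mulr_suml.
apply: ler_sum => x _; apply: ler_wpM2l => //.
by apply: prodr_ge0 => j _; apply: pinned_kernel_ge0.
Qed.

(** Each letter is summed separately, and the kernel is balanced, so every
    solution gets the same total weight. *)
Lemma sum_smoothing u :
  \sum_a smoothing x0 u a = (#|A|%:R / #|T|%:R) ^+ #|V| * \sum_x u x.
Proof.
rewrite /smoothing exchange_big mulr_sumr; apply: eq_bigr => x _ /=.
rewrite -mulr_suml.
rewrite -(bigA_distr_bigA (fun j a => pinned_kernel (x0 j) a (x j))).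
congr (_ * _); under eq_bigr => j _ do rewrite pinned_kernel_balanced.
by rewrite prodr_const.
Qed.

(** Outside S the kernels integrate to 1 whatever the letters are.  To see
    this, solutions are grouped by their restriction to S, encoded as the
    solution r x that agrees with x on S and with x0 elsewhere; each group is a
    product set. *)
Lemma smoothing_local S u :
  depends_only_on S u -> depends_only_on S (smoothing x0 u).
Proof.
move=> u_local a b eq_ab.
pose r (x : {ffun V -> T}) := [ffun j => if j \in S then x j else x0 j].
have u_r x : u (r x) = u x by apply: u_local => j jS; rewrite ffunE jS.
have rK x : r (r x) = r x by apply/ffunP => j; rewrite !ffunE; case: (j \in S).
pose Q (y : {ffun V -> T}) j t := (j \in S) ==> (t == y j).
have fibre y : r y == y -> (fun x => r x == y) =1 [in family (Q y)].
  move=> /eqP ry x; apply/eqP/familyP => [<- j | xQ].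
    by rewrite /in_mem /= /Q ffunE; case: ifP => //= _; rewrite eqxx.
  apply/ffunP => j; rewrite -ry !ffunE; case: ifP => // jS.
  by have := xQ j; rewrite /in_mem /= /Q jS => /eqP.
have smoothingE (c : {ffun V -> A}) : smoothing x0 u c =
    \sum_(y | r y == y)
      (\prod_j \sum_(t | Q y j t) pinned_kernel (x0 j) (c j) t) * u y.
  rewrite /smoothing (partition_big r (fun y => r y == y)) /=; last first.
    by move=> x _; rewrite rK.
  apply: eq_bigr => y ry; rewrite bigA_distr_big_dep mulr_suml.
  rewrite (eq_bigl _ _ (fibre y ry)); apply: eq_bigr => x.
  by rewrite -fibre // => /eqP <-; rewrite u_r.
rewrite !smoothingE; apply: eq_bigr => y _; congr (_ * _).
apply: eq_bigr => j _.
have [jS | jS] := boolP (j \in S); first by rewrite eq_ab.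
have Qtrue t : Q y j t by rewrite /Q (negbTE jS).
by rewrite !(eq_bigl predT) // !sum_pinned_kernel.
Qed.

End Smoothing.

(** * Linear orthogonal arrays *)

(** Strength k is expressed as the possibility of interpolating any values on
    at most k columns.  As the columns are additive, this is equivalent to the
    usual condition that on any at most k columns each tuple of letters appears
    equally often. *)
Definition orthogonal_array (k : nat) (C : finType) (G A : finZmodType)
    (f : C -> G -> A) :=
  (forall c, {morph f c : g h / g + h}) /\
  (forall (S : {set C}) (y : C -> A), (#|S| <= k)%N ->
     exists g, {in S, forall c, f c g = y c}).

Section Averaging.

Variables (R : realFieldType) (V C : finType) (G A : finZmodType).
Variables (k : nat) (f : C -> G -> A).
Hypothesis f_array : orthogonal_array k f.

Definition array_row (col : V -> C) (g : G) : {ffun V -> A} :=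
  [ffun j => f (col j) g].

Lemma array_row0 col : array_row col 0 = [ffun=> 0].
Proof.
apply/ffunP => j; rewrite !ffunE; apply: (addrI (f (col j) 0)).
by rewrite -f_array.1 !addr0.
Qed.

(** Translating G by an element that interpolates a on the colours of S does
    not change the left-hand sum and translates its argument by a on S.
    Averaging over all a makes the argument uniform. *)
Lemma array_average (col : V -> C) (S : {set V}) (h : {ffun V -> A} -> R) :
  depends_only_on S h -> (#|S| <= k)%N -> {in S &, injective col} ->
  #|A|%:R ^+ #|V| * \sum_g h (array_row col g) = #|G|%:R * \sum_a h a.
Proof.
move=> h_local leSk col_inj.
pose shift (b a : {ffun V -> A}) := [ffun j => b j + a j].
have shift_inj b : injective (shift b).
  by move=> a a' /ffunP eq_s; apply/ffunP => j;
    have := eq_s j; rewrite !ffunE => /addrI.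
have translated a :
    \sum_g h (array_row col g) = \sum_g h (shift (array_row col g) a).
  (* The values at the variables of S are transported to their colours. *)
  have [g0 g0P] : exists g0, {in S, forall j, f (col j) g0 = a j}.
    pose y c := if [pick j in S | col j == c] is Some j then a j else 0.
    have [g0 g0P] := f_array.2 (col @: S) y
      (leq_trans (leq_imset_card _ _) leSk).
    exists g0 => j jS; rewrite g0P ?imset_f // /y.
    case: pickP => [i /andP[iS /eqP /col_inj -> //] | /(_ j)].
    by rewrite jS eqxx.
  rewrite (reindex_inj (addIr g0)) /=; apply: eq_bigr => g _.
  by apply: h_local => j jS; rewrite !ffunE f_array.1 g0P.
transitivity (\sum_(a : {ffun V -> A}) \sum_g h (array_row col g)).
  by rewrite sum_const card_ffun natrX.
rewrite (eq_bigr _ (fun a _ => translated a)) exchange_big /=.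
transitivity (\sum_(g : G) \sum_a h a); last by rewrite sum_const.
apply: eq_bigr => g _.
by rewrite [RHS](reindex_inj (shift_inj (array_row col g))).
Qed.

End Averaging.

(** The mean of v is its smoothed average over the words of the array, where
    the zero word contributes v x0 and every other word at least lo. *)
Lemma mean_sub_ge (R : realFieldType) (V T C : finType) (G A : finZmodType)
    (k m : nat) (f : C -> G -> A) (col : V -> C) (S : 'I_m -> {set V})
    (u : 'I_m -> {ffun V -> T} -> R) (x0 : {ffun V -> T}) (lo : R) :
  orthogonal_array k f -> (1 < #|A|)%N -> (0 < #|T| <= #|A|)%N ->
  (forall i, (#|S i| <= k)%N) -> (forall i, {in S i &, injective col}) ->
  (forall i, depends_only_on (S i) (u i)) ->
  let v x := \sum_i u i x in
  (forall x, lo <= v x) ->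
  (v x0 - lo) / #|G|%:R <= (\sum_x v x) / #|{ffun V -> T}|%:R - lo.
Proof.
move=> f_array A_gt1 /andP[T_gt0 leTA] leSk col_inj u_local v lo_v.
pose w := smoothing (A := A) x0 v.
have G_gt0 : 0 < #|G|%:R :> R by rewrite ltr0n; apply/card_gt0P; exists 0.
have A_gt0 : 0 < #|A|%:R :> R by rewrite ltr0n ltnW.
have TR_gt0 : 0 < #|T|%:R :> R by rewrite ltr0n.
have wE a : w a = \sum_i smoothing (A := A) x0 (u i) a.
  rewrite /w /smoothing exchange_big; apply: eq_bigr => x _.
  by rewrite mulr_sumr.
have w_average :
    #|A|%:R ^+ #|V| * \sum_g w (array_row f col g) = #|G|%:R * \sum_a w a.
  rewrite !(eq_bigr _ (fun _ _ => wE _)) exchange_big [in RHS]exchange_big /=.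
  rewrite !mulr_sumr; apply: eq_bigr => i _.
  apply: (array_average f_array _ (leSk i)) (col_inj i).
  exact: smoothing_local.
have -> : (\sum_x v x) / #|{ffun V -> T}|%:R =
    (\sum_g w (array_row f col g)) / #|G|%:R.
  apply: (mulfI (lt0r_neq0 G_gt0)); rewrite [RHS]mulrC divfK ?lt0r_neq0 //.
  apply: (mulfI (lt0r_neq0 (exprn_gt0 #|V| A_gt0))).
  rewrite w_average /w sum_smoothing // card_ffun natrX expr_div_n.
  by field; rewrite expf_neq0 ?lt0r_neq0.
have row_ge : v x0 + (#|G|%:R - 1) * lo <= \sum_g w (array_row f col g).
  rewrite (bigD1 0) //= (array_row0 f_array) /w smoothing0 lerD2l.
  have -> : (#|G|%:R - 1) * lo = \sum_(g : G | g != 0) lo.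
    by rewrite sum_const_neq0.
  by apply: ler_sum => g _; apply: smoothing_ge.
rewrite ler_pdivrMr // mulrBl divfK ?lt0r_neq0 //; nra.
Qed.

(** * The average differential ratio of an instance *)

Lemma maximum_attained (R : realType) (T : finType) (f : T -> R) (t0 : T) :
  exists2 x, maximum f = f x & forall y, f y <= f x.
Proof.
rewrite /maximum; case: pickP => [x /forallP xP | no_max]; first by exists x.
case: (@Order.TotalTheory.arg_maxP _ _ _ t0 xpredT f) => // x _ x_max.
by have /forallP[] := negbT (no_max x); move=> y; apply: x_max.
Qed.

Lemma minimum_attained (R : realType) (T : finType) (f : T -> R) (t0 : T) :
  exists2 x, minimum f = f x & forall y, f x <= f y.
Proof.
rewrite /minimum; case: pickP => [x /forallP xP | no_min]; first by exists x.
case: (@Order.TotalTheory.arg_minP _ _ _ t0 xpredT f) => // x _ x_min.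
by have /forallP[] := negbT (no_min x); move=> y; apply: x_min.
Qed.

Lemma scope_injective_coloring (R : realType) (k q : nat)
    (I : csp_instance R k q) (C : finType) :
  (strong_chromatic_number I <= #|C|)%N ->
  exists col : 'I_(nvars I) -> C,
    forall i, {in [set j in scope (c:=I) i] &, injective col}.
Proof.
rewrite /strong_chromatic_number; case: ex_minnP => nu.
case/existsP => P /andP[/andP[partP /forallP P_strong] /eqP <-] _ leC.
have coverP j : j \in cover P by rewrite (cover_partition partP) inE.
have blockP j : pblock P j \in P by rewrite pblock_mem.
exists (fun j =>
  enum_val (widen_ord leC (enum_rank_in (blockP j) (pblock P j)))).
move=> i j j' ji j'i /enum_val_inj eq_rank.
have {}eq_rank : enum_rank_in (blockP j) (pblock P j) =
    enum_rank_in (blockP j') (pblock P j').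
  by apply: val_inj; apply: (congr1 val eq_rank).
have eq_block : pblock P j = pblock P j'.
  rewrite -(enum_rankK_in (blockP j) (blockP j)) eq_rank.
  by rewrite (enum_rankK_in (blockP j') (blockP j')).
have /forall_inP/(_ _ (blockP j))/card_le1_eqP := P_strong i.
by apply; rewrite inE ?ji ?j'i andbT ?mem_pblock // eq_block mem_pblock.
Qed.

(** Minimizing v amounts to maximizing - v, for which the bound of
    [mean_sub_ge] is read at a minimizer of v. *)
Lemma average_differential_ratio_ge (R : realType) (k q : nat)
    (I : csp_instance R k q) (C : finType) (G A : finZmodType)
    (f : C -> G -> A) :
  orthogonal_array k f -> (strong_chromatic_number I <= #|C|)%N ->
  (2 <= q <= #|A|)%N -> opt I <> wor I ->
  1 / #|G|%:R <= average_differential_ratio I.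
Proof.
move=> f_array le_nuC /andP[q_ge2 le_qA] opt_neq_wor.
have [col col_inj] := scope_injective_coloring le_nuC.
pose S i := [set j in scope (c:=I) i].
have leSk i : (#|S i| <= k)%N.
  rewrite cardsE (leq_trans (card_size _)) // size_tuple.
  by have /andP[_] := arity_bounds i; rewrite leq_min => /andP[].
have termP i : depends_only_on (S i) (fun x : solution I =>
    weight i * payoff (map_tuple x (scope (c:=I) i))).
  move=> x y eq_xy; congr (_ * payoff _); apply: val_inj => /=.
  by apply/eq_in_map => j ji; apply: eq_xy; rewrite inE.
have oppP i : depends_only_on (S i) (fun x : solution I =>
    - (weight i * payoff (map_tuple x (scope (c:=I) i)))).
  by move=> x y /termP ->.
have sum_opp (x : solution I) :
    \sum_i - (weight i * payoff (map_tuple x (scope (c:=I) i))) = - value x.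
  by rewrite sumrN.
pose x1 : solution I := [ffun=> Ordinal (ltnW q_ge2)].
have [xM maxE maxP] := maximum_attained (@value R k q I) x1.
have [xm minE minP] := minimum_attained (@value R k q I) x1.
have A_gt1 : (1 < #|A|)%N by apply: leq_trans le_qA.
have T_bounds : (0 < #|'I_q| <= #|A|)%N by rewrite card_ord ltnW.
move: opt_neq_wor.
rewrite /average_differential_ratio /uniform_mean /opt /wor maxE minE.
case: (goal I) => /eqP neq.
- have gap : 0 < value xM - value xm.
    by rewrite subr_gt0 lt_neqAle eq_sym neq maxP.
  rewrite ler_pdivlMr // mul1r mulrC.
  exact: (mean_sub_ge (lo := value xm) xM f_array A_gt1 T_bounds leSk
    col_inj termP).
have gap : 0 < value xM - value xm by rewrite subr_gt0 lt_neqAle neq maxP.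
have lo_opp (x : solution I) : - value xM <=
    \sum_i - (weight i * payoff (map_tuple x (scope (c:=I) i))).
  by rewrite sum_opp lerN2.
have := mean_sub_ge xm f_array A_gt1 T_bounds leSk col_inj oppP lo_opp.
rewrite /= sum_opp (eq_bigr _ (fun x _ => sum_opp x)) sumrN.
rewrite -[X in _ -> _ <= X]mulrNN -invrN !opprB ler_pdivlMr // mul1r mulrC.
by rewrite opprK [- _ + _]addrC mulNr [- _ + _]addrC.
Qed.

(** * Three families of orthogonal arrays *)

(** At most k of the k + 1 columns always leave one out, whose entry can be chosen
    to make the sum of the word vanish. *)
Lemma parity_array (k n : nat) :
  orthogonal_array k (fun (c : option 'I_k) (g : 'rV['I_n.+1]_k) =>
    if c is Some i then g 0 i else - \sum_i g 0 i).
Proof.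
split=> [[i|] g h | S y leSk]; first by rewrite mxE.
  rewrite -opprD -big_split; congr (- _); apply: eq_bigr => i _.
  by rewrite mxE.
have [c cS] : exists c, c \notin S.
  apply/existsP; rewrite -negb_forall; apply/negP => /forallP allS.
  have: (#|{: option 'I_k}| <= #|S|)%N by apply/subset_leq_card/subsetP.
  by rewrite card_option card_ord ltnNge leSk.
case: c cS => [i0|] cS; last first.
  exists (\row_i y (Some i)) => -[i|] // cS'; first by rewrite mxE.
  by rewrite cS' in cS.
pose t := - y None - \sum_(i | i != i0) y (Some i).
exists (\row_i if i == i0 then t else y (Some i)) => -[i|] iS.
  by rewrite mxE; case: eqP => // eq_i; rewrite eq_i (negbTE cS) in iS.
rewrite (bigD1 i0) //= mxE eqxx (eq_bigr (fun i => y (Some i)))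
  => [|i /negbTE ne].
  by rewrite /t subrK opprK.
by rewrite mxE ne.
Qed.

(** Lagrange interpolation at the points h c. *)
Lemma interpolation (F : fieldType) (T : finType) (S : {set T})
    (h y : T -> F) : {in S &, injective h} ->
  exists2 p : {poly F}, (size p <= #|S|)%N & {in S, forall c, p.[h c] = y c}.
Proof.
move=> h_inj; pose b c := \prod_(d in S :\ c) ('X - (h d)%:P).
exists (\sum_(c in S) (y c / (b c).[h c]) *: b c).
  apply: (leq_trans (size_sum _ _ _)); apply/bigmax_leqP => c cS.
  rewrite (leq_trans (size_scale_leq _ _)) // /b -big_enum.
  by rewrite size_prod_XsubC -cardE (cardsD1 c S) cS.
move=> c cS; rewrite horner_sum (bigD1 c) //= hornerZ big1 ?addr0.
  rewrite divfK // /b horner_prod; apply/prodf_neq0 => d.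
  rewrite !inE hornerXsubC subr_eq0 => /andP[d_neq dS].
  by apply: contra d_neq => /eqP /h_inj ->.
move=> d /andP[dS d_neq]; suff bd0 : (b d).[h c] = 0.
  by rewrite hornerZ bd0 mulr0.
rewrite /b horner_prod (bigD1 c) /=; first by rewrite hornerXsubC subrr mul0r.
by rewrite !inE eq_sym d_neq.
Qed.

Lemma card_preim_Some (T : finType) (S : {set option T}) :
  (#|[set x | Some x \in S]| + (None \in S) <= #|S|)%N.
Proof.
rewrite (cardsD1 None S) addnC leq_add2l -(card_imset _ Some_inj).
apply/subset_leq_card/subsetP => c.
by case/imsetP => x; rewrite !inE => xS ->.
Qed.

(** The column None is the point at infinity, where a polynomial takes its
    coefficient of degree k as value.  Prescribing it costs one degree, and it
    also accounts for one of the columns of S. *)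
Lemma reed_solomon_array (F : finFieldType) (k : nat) :
  orthogonal_array k.+1 (fun (c : option F) (g : 'rV[F]_k.+1) =>
    if c is Some x then (rVpoly g).[x] else (rVpoly g)`_k).
Proof.
split=> [[x|] g h | S y leSk]; try by rewrite linearD ?hornerD ?coefD.
have [S_inf | S_fin] := boolP (None \in S).
  have leS'k : (#|[set x : F | Some x \in S]| <= k)%N.
    by have := leq_trans (card_preim_Some S) leSk; rewrite S_inf addn1.
  have [r r_size rP] := @interpolation F F [set x | Some x \in S] id
    (fun x => y (Some x) - y None * x ^+ k) (in2W (@inj_id F)).
  pose p := r + y None *: 'X^k.
  have p_size : (size p <= k.+1)%N.
    rewrite (leq_trans (size_polyD _ _)) // geq_max; apply/andP; split.
      by rewrite (leq_trans r_size) // leqW.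
    by rewrite (leq_trans (size_scale_leq _ _)) // size_polyXn.
  exists (poly_rV p) => -[x|] cS; rewrite poly_rV_K //.
    by rewrite hornerD hornerZ hornerXn (rP x) ?inE // subrK.
  rewrite coefD coefZ coefXn eqxx mulr1 nth_default ?add0r //.
  exact: leq_trans leS'k.
have leS'k : (#|[set x : F | Some x \in S]| <= k.+1)%N.
  exact: leq_trans (leq_trans (leq_addr _ _) (card_preim_Some S)) leSk.
have [r r_size rP] := @interpolation F F [set x | Some x \in S] id
  (fun x => y (Some x)) (in2W (@inj_id F)).
exists (poly_rV r) => -[x|] cS; last by rewrite cS in S_fin.
by rewrite poly_rV_K ?(leq_trans r_size) // rP // inE.
Qed.

(** The columns of a polynomial g0 + g1 X + g2 X^2 are its values, g2 at the
    point at infinity, and g1 at the nucleus.  Once g1 is prescribed, there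
    remain at most two conditions on g0 + g2 x^2, which is linear in x^2; in
    characteristic 2 squaring is bijective, so these are Reed-Solomon
    conditions of strength 2 at the squared points. *)
Lemma hyperoval_array (F : finFieldType) : 2 \in [pchar F] ->
  orthogonal_array 3 (fun (c : option (option F)) (g : 'rV[F]_3) =>
    match c with
    | Some (Some x) => (rVpoly g).[x]
    | Some None => (rVpoly g)`_2
    | None => (rVpoly g)`_1
    end).
Proof.
move=> charF2; split=> [[[x|]|] g h | S y leS3];
  try by rewrite linearD ?hornerD ?coefD.
have [S_nuc | S_nuc] := boolP (None \in S); last first.
  have leS'3 : (#|[set c : option F | Some c \in S]| <= 3)%N.
    exact: leq_trans (leq_trans (leq_addr _ _) (card_preim_Some S)) leS3.
  have [g gP] := (reed_solomon_array F 2).2 _ (y \o Some) leS'3.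
  exists g => -[c|] cS; last by rewrite cS in S_nuc.
  by have := gP c; rewrite inE => /(_ cS); case: c {cS}.
have sqr_inj : injective (fun x : F => x ^+ 2).
  by move=> x z; rewrite -!(pFrobenius_autE charF2); apply: fmorph_inj.
pose sqr_col (c : option F) := omap (fun x => x ^+ 2) c.
pose y' (c : option F) :=
  if c is Some z then
    let x := invF sqr_inj z in y (Some (Some x)) - y None * x
  else y (Some None).
have leS'2 : (#|sqr_col @: [set c : option F | Some c \in S]| <= 2)%N.
  rewrite (leq_trans (leq_imset_card _ _)) //.
  by have := leq_trans (card_preim_Some S) leS3; rewrite S_nuc addn1.
have [g gP] := (reed_solomon_array F 1).2 _ y' leS'2.
pose p := rVpoly g \Po 'X^2 + y None *: 'X.
have p_size : (size p <= 3)%N.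
  have r_size : (size (rVpoly g) <= 2)%N by apply: size_poly.
  rewrite (leq_trans (size_polyD _ _)) // geq_max; apply/andP; split.
    rewrite (leq_trans (size_comp_poly_leq _ _)) // size_polyXn /=.
    by move: r_size; case: (size _) => [|[|[]]].
  by rewrite (leq_trans (size_scale_leq _ _)) // size_polyX.
exists (poly_rV p) => -[c|] cS; rewrite poly_rV_K //.
  have := gP (sqr_col c); rewrite imset_f ?inE // => /(_ isT).
  case: c {cS} => [x|] /= gc.
    rewrite hornerD horner_comp hornerXn gc hornerZ hornerX invF_f.
    by rewrite subrK.
  by rewrite coefD coef_comp_poly_Xn //= gc coefZ coefX mulr0 addr0.
by rewrite coefD coef_comp_poly_Xn //= coefZ coefX mulr1 add0r.
Qed.

(** * Bounds for the available alphabet sizes *)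

Lemma ratio_ge_parity (R : realType) (k q : nat) (I : csp_instance R k q) :
  (2 <= q)%N -> (strong_chromatic_number I <= k + 1)%N -> opt I <> wor I ->
  1 / q%:R ^+ k <= average_differential_ratio I.
Proof.
case: q I => // n I q_ge2 le_nu opt_neq_wor.
have := average_differential_ratio_ge (parity_array k n) _ _ opt_neq_wor.
rewrite card_option !card_ord card_mx card_ord mul1n natrX q_ge2 leqnn.
by rewrite addn1 in le_nu; apply.
Qed.

Lemma ratio_ge_reed_solomon (R : realType) (k q p kappa : nat)
    (I : csp_instance R k q) :
  (0 < k)%N -> prime p -> (0 < kappa)%N -> (2 <= q <= p ^ kappa)%N ->
  (strong_chromatic_number I <= p ^ kappa + 1)%N -> opt I <> wor I ->
  1 / (p ^ kappa)%:R ^+ k <= average_differential_ratio I.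
Proof.
case: k I => // k I _ p_prime kappa_gt0 q_bounds le_nu opt_neq_wor.
have [F _ cardF] := PrimePowerField p_prime kappa_gt0.
have := average_differential_ratio_ge (reed_solomon_array F k) _ _ opt_neq_wor.
rewrite card_option card_mx cardF mul1n natrX q_bounds.
by rewrite addn1 in le_nu; apply.
Qed.

Lemma ratio_ge_hyperoval (R : realType) (q e : nat) (I : csp_instance R 3 q) :
  (0 < e)%N -> (2 <= q <= 2 ^ e)%N ->
  (strong_chromatic_number I <= 2 ^ e + 2)%N -> opt I <> wor I ->
  1 / (2 ^ e)%:R ^+ 3 <= average_differential_ratio I.
Proof.
move=> e_gt0 q_bounds le_nu opt_neq_wor.
have [F charF cardF] := PrimePowerField (isT : prime 2) e_gt0.
have := average_differential_ratio_ge (hyperoval_array charF) _ _ opt_neq_wor.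
rewrite !card_option card_mx cardF mul1n natrX q_bounds.
by rewrite addn2 in le_nu; apply.
Qed.

Lemma exp_up_log_le (q : nat) : (2 <= q)%N -> (2 ^ up_log 2 q <= 2 * q - 2)%N.
Proof.
move=> q_ge2; have := up_log_gtn (isT : 1 < 2)%N q_ge2.
have := up_log_gt0 2 q; rewrite q_ge2 => e_gt0.
by rewrite -[in X in (_ -> X)%type](prednK e_gt0) expnS; lia.
Qed.

Lemma inv_expr_double_le (R : realType) (q N k : nat) :
  (2 <= q)%N -> (0 < N <= 2 * q - 2)%N ->
  1 / (2 * q%:R - 2) ^+ k <= 1 / N%:R ^+ k :> R.
Proof.
move=> q_ge2 /andP[N_gt0 leN].
have leNR : N%:R <= 2 * q%:R - 2 :> R.
  by rewrite -natrM -natrB ?ler_nat //; lia.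
have NR_gt0 : 0 < N%:R :> R by rewrite ltr0n.
rewrite !div1r lef_pV2 ?posrE ?exprn_gt0 ?(lt_le_trans NR_gt0) //.
by apply: lerXn2r; rewrite ?nnegrE ?ler0n // (le_trans (ler0n _ N)).
Qed.

Theorem corollary2p2 (R : realType) (q k : nat) (hq : (2 <= q)%N)
    (hk : (2 <= k)%N) (I : csp_instance R k q) (nu : nat)
    (hnu : nu = strong_chromatic_number I)
    (hnu_range : (k <= nu <= maxn k.+1 (2 * q))%N)
    (p kappa : nat) (hp : prime p) (hkappa : (1 <= kappa)%N)
    (hpk : smallest_prime_power_geq q (p ^ kappa))
    (hI : opt I <> wor I) :
  [/\ ((nu <= k + 1)%N \/
       [/\ (k < q)%N, prime_power q & (nu <= q + 1)%N] \/
       [/\ k = 3%N, (3 < q)%N, exists e : nat, q = (2 ^ e)%N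
         & (nu <= q + 2)%N]) ->
      1 / q%:R ^+ k <= average_differential_ratio I,
      (k < p ^ kappa)%N -> (nu <= p ^ kappa + 1)%N ->
      1 / p%:R ^+ (kappa * k) <= average_differential_ratio I /\
      1 / (2 * q%:R - 2) ^+ k <= average_differential_ratio I
    & k = 3%N -> (3 <= q)%N -> (nu <= 2 ^ up_log 2 q + 2)%N ->
      1 / 2 ^+ (3 * up_log 2 q) <= average_differential_ratio I /\
      1 / (2 * q%:R - 2) ^+ 3 <= average_differential_ratio I].
Proof.
have [_ le_q_pk pk_min] := hpk.
have k_gt0 : (0 < k)%N by apply: ltnW.
have e_gt0 : (0 < up_log 2 q)%N by rewrite up_log_gt0 hq.
have le_q_2e : (q <= 2 ^ up_log 2 q)%N := up_logP q (isT : 1 < 2)%N.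
split.
- case=> [le_nu | [[_ [r [c [r_prime c_gt0 def_q]]] le_nu]
              | [k3 q_gt3 [e def_q] le_nu]]].
  + by apply: ratio_ge_parity; rewrite -?hnu.
  + rewrite [in X in X <= _]def_q.
    by apply: ratio_ge_reed_solomon; rewrite -?def_q ?hq -?hnu //=.
  + move: I hnu hI; rewrite k3 => J hnuJ hJ.
    rewrite [in X in X <= _]def_q; apply: ratio_ge_hyperoval => //.
    * by case: e def_q q_gt3 => // ->.
    * by rewrite -def_q hq /=.
    * by rewrite -def_q -hnuJ.
- move=> _ le_nu.
  have bound : 1 / (p ^ kappa)%:R ^+ k <= average_differential_ratio I.
    by apply: ratio_ge_reed_solomon; rewrite // ?hq -?hnu.
  split; first by rewrite exprM -natrX.
  apply: le_trans bound; apply: inv_expr_double_le => //.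
  rewrite (leq_trans (ltnW hq)) //=; apply: leq_trans (exp_up_log_le hq).
  by apply: pk_min => //; exists 2%N, (up_log 2 q).
- move=> k3 _ le_nu; move: I hnu hI; rewrite k3 => J hnuJ hJ.
  have bound : 1 / (2 ^ up_log 2 q)%:R ^+ 3 <= average_differential_ratio J.
    by apply: ratio_ge_hyperoval; rewrite // ?hq -?hnuJ.
  split; first by rewrite mulnC exprM -natrX.
  apply: le_trans bound; apply: inv_expr_double_le => //.
  by rewrite expn_gt0 exp_up_log_le.
Qed.
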